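(* Let $(\Omega,\mathcal{A})$ be a measurable space, let $X$ and $Y$ be Banach spaces, let $\nu:\mathcal{A}\to Y$ be a $\sigma$-additive vector measure, and let $1\le p<\infty$. Then $L^p(\nu,X,Y)$ is a closed subspace of $L^p_w(\nu,X,Y)$ (closed with respect to the norm $\|\cdot\|_{L^p_w(\nu,X,Y)}$).
   Context: $Y'$ denotes the dual of $Y$. For $y'\in Y'$, $y'\circ\nu$ is the scalar measure $E\mapsto y'(\nu(E))$ and $|y'\circ\nu|$ is its total variation measure. The semivariation of $\nu$ is $\|\nu\|(E)=\sup_{\|y'\|\le 1}|y'\circ\nu|(E)$; ''almost everywhere'' and equivalence classes refer to sets $E\in\mathcal{A}$ with $\|\nu\|(E)=0$ being null. A simple function is a finite sum $\sum_i x_i\chi_{A_i}$ with $x_i\in X$, $A_i\in\mathcal{A}$. A function $f:\Omega\to X$ is $\nu$-measurable (strongly measurable) if there is a sequence of simple functions converging to $f$ in the norm of $X$, $\|\nu\|$-almost everywhere. $L^p_w(\nu,X,Y)$ ($1\le p<\infty$) is the space of ($\|\nu\|$-equivalence classes of) $\nu$-measurable functions $f:\Omega\to X$ such that $\int_\Omega\|f\|^p\,d|y'\circ\nu|<\infty$ for every $y'\in Y'$, with norm $$\|f\|_{L^p_w(\nu,X,Y)}=\sup_{\|y'\|\le1}\left(\int_\Omega\|f\|^p\,d|y'\circ\nu|\right)^{1/p}.$$ $L^p(\nu,X,Y)$ ($1\le p<\infty$) is the space of ($\|\nu\|$-equivalence classes of) $\otimes$-integrable functions of order $p$, that is, $\nu$-measurable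 functions $f:\Omega\to X$ for which there is a sequence of simple functions $(f_n)_{n\in\mathbb{N}}$ from $\Omega$ to $X$ with $$\lim_{n\to\infty}\sup_{\|y'\|\le1}\left(\int_\Omega\|f-f_n\|^p\,d|y'\circ\nu|\right)^{1/p}=0 ,$$ with norm $\|f\|_{L^p(\nu,X,Y)}=\sup_{\|y'\|\le1}\left(\int_\Omega\|f\|^p\,d|y'\circ\nu|\right)^{1/p}$. *)

(* Defs.v *)
From HB Require Import structures.
From mathcomp Require Import all_boot all_order all_algebra.
From mathcomp Require Import ring_quotient.
From mathcomp Require Import complex.
From mathcomp Require Import all_classical all_reals all_analysis.

Set Implicit Arguments.
Unset Strict Implicit.
Unset Printing Implicit Defensive.

Import Order.TTheory GRing.Theory Num.Theory.
Import numFieldNormedType.Exports.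

Local Open Scope classical_set_scope.
Local Open Scope ring_scope.

(* Banach spaces are real or complex: [scalar_field R K] says that [K] is the
   field of real numbers [R] or the field of complex numbers [R[i]]. *)
Variant scalar_field (R : realType) : numFieldType -> Type :=
| RealScalars : scalar_field R R
| ComplexScalars : scalar_field R R[i].

Definition real_part (R : realType) (K : numFieldType)
    (s : scalar_field R K) : K -> R :=
  match s in scalar_field _ K return K -> R with
  | RealScalars => id
  | ComplexScalars => @complex.Re R
  end.

(* The norm of a [normedModType K] takes its values in [K]; this is the same
   nonnegative number as an element of [R]. *)
Definition rnorm (R : realType) (K : numFieldType) (s : scalar_field R K)
    (V : normedModType K) (v : V) : R := real_part s `|v|.

Record vector_measure d (Omega : measurableType d) (K : numFieldType)
    (Y : normedModType K) := VectorMeasure {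
  vector_measure_fun :> set Omega -> Y ;
  vector_measure_sigma_additive : forall A : (set Omega)^nat,
    (forall i, measurable (A i)) -> trivIset setT A ->
    (fun n => \sum_(0 <= i < n) vector_measure_fun (A i)) @ \oo -->
      vector_measure_fun (\bigcup_i A i) }.

Section variation.
Context d (Omega : measurableType d) (R : realType) (K : numFieldType).
Variable s : scalar_field R K.
Local Open Scope ereal_scope.

(* For a measurable [E], restricting to families whose union is [E] gives the
   same supremum; with families of subsets of [E] the value is nonnegative for
   every [E], as the library requires of a measure. *)
Definition variation (mu : set Omega -> K^o) (E : set Omega) : \bar R :=
  ereal_sup [set z | exists n (A : 'I_n -> set Omega),
    [/\ forall i, measurable (A i), trivIset setT A, forall i, A i `<=` E &
        z = \sum_(i < n) (rnorm s (mu (A i)))%:E]].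

Context (Y : normedModType K).

Definition dual_norm (y' : {linear Y -> K^o}) : \bar R :=
  ereal_sup [set (rnorm s (y' y))%:E | y in [set y | (rnorm s y <= 1)%R]].

Definition dual_ball : set {linear Y -> K^o} :=
  [set y' : {linear Y -> K^o} | continuous y' /\ dual_norm y' <= 1].

Definition scalar_measure (nu : vector_measure Omega Y)
    (y' : {linear Y -> K^o}) : set Omega -> K^o := fun E => y' (nu E).

Definition semivariation (nu : vector_measure Omega Y) (E : set Omega) :
  \bar R := ereal_sup [set variation (scalar_measure nu y') E | y' in dual_ball].

End variation.
Arguments dual_ball {R K} s Y _.

Section function_spaces.
Context d (Omega : measurableType d) (R : realType) (K : numFieldType).
Context (s : scalar_field R K) (X Y : normedModType K).
Variables (nu : vector_measure Omega Y) (p : R).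

Definition simple_function (f : Omega -> X) : Prop :=
  exists n (A : 'I_n -> set Omega) (x : 'I_n -> X),
    (forall i, measurable (A i)) /\
    f = fun w => \sum_(i < n) (\1_(A i) w : K) *: x i.

Definition strongly_measurable (f : Omega -> X) : Prop :=
  exists f_ : nat -> Omega -> X, (forall n, simple_function (f_ n)) /\
    \forall w \ae semivariation s nu, f_ n w @[n --> \oo] --> f w.

(* [\int] is the supremum of the integrals of the simple functions below the
   integrand, so that it is unaffected by [rnorm s (f w)] being measurable only
   off a null set. *)
Definition integral_normp (f : Omega -> X) (y' : {linear Y -> K^o}) : \bar R :=
  (\int[variation s (scalar_measure nu y')]_w (rnorm s (f w) `^ p)%:E)%E.

Definition Lpw_norm_fun (f : Omega -> X) : \bar R :=
  ereal_sup [set (integral_normp f y' `^ p^-1)%E | y' in dual_ball s Y].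

Definition Lpw_fun (f : Omega -> X) : Prop :=
  strongly_measurable f /\
  forall y' : {linear Y -> K^o}, continuous y' ->
    (integral_normp f y' < +oo)%E.

Definition Lp_fun (f : Omega -> X) : Prop :=
  strongly_measurable f /\
  exists f_ : nat -> Omega -> X, (forall n, simple_function (f_ n)) /\
    Lpw_norm_fun (fun w => f w - f_ n w) @[n --> \oo] --> 0%E.

End function_spaces.

Section null_sets.
Context d (Omega : measurableType d) (R : realType) (K : numFieldType).
Context (s : scalar_field R K) (Y : normedModType K).
Variable nu : vector_measure Omega Y.
Implicit Types A B E : set Omega.

Lemma rnorm_ge0 (V : normedModType K) (v : V) : 0 <= rnorm s v.
Proof.
rewrite /rnorm; case: K / s V v => V v /=; first exact: normr_ge0.
by have := normr_ge0 v; case: (`|v|) => a b; rewrite lecE => /andP[].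
Qed.

Lemma rnorm_eq0 (V : normedModType K) (v : V) : rnorm s v = 0 -> v = 0.
Proof.
rewrite /rnorm; case: K / s V v => V v /=; first exact: normr0_eq0.
move=> n0; apply: normr0_eq0; have := normr_ge0 v.
by case: (`|v|) n0 => a b /= ->; rewrite lecE /= => /andP[/eqP -> _].
Qed.

Lemma rnorm0 (V : normedModType K) : rnorm s (0 : V) = 0.
Proof. by rewrite /rnorm; case: K / s V => V /=; rewrite normr0. Qed.

Lemma vector_measure0 : nu set0 = 0.
Proof.
have t0 : trivIset [set: nat] (fun=> set0 : set Omega).
  by apply/trivIsetP => i j _ _ _; rewrite setI0.
have h := @vector_measure_sigma_additive _ _ _ _ nu _ (fun=> measurable0) t0.
rewrite bigcup0// in h.
have c0 := @cvg_series_cvg_0 _ Y (fun=> nu set0) (cvgP _ h).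
exact: (cvg_unique _ (cvg_cst _) c0).
Qed.

Lemma vector_measureU A B : measurable A -> measurable B ->
  A `&` B = set0 -> nu (A `|` B) = nu A + nu B.
Proof.
move=> mA mB AB.
have mAB i : measurable (bigcup2 A B i).
  by case: i => [|[|i]] //=; exact: measurable0.
have tAB : trivIset setT (bigcup2 A B) by rewrite -trivIset_bigcup2.
have h := @vector_measure_sigma_additive _ _ _ _ nu _ mAB tAB.
rewrite bigcup2E in h; apply: (cvg_unique _ h) => //; apply: cvg_near_cst.
near=> n; have n2 : (2 <= n)%N by near: n; exists 2%N.
rewrite big_ltn ?(leq_trans _ n2)// big_ltn//= big_nat_cond.
rewrite big1 ?addr0// => -[|[|i]]// _.
exact: vector_measure0.
Unshelve. all: by end_near. Qed.

Lemma dual_ball0 : dual_ball s Y (\0 : {linear Y -> K^o}).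
Proof.
split; first by move=> x; exact: cvg_cst.
by apply: ge_ereal_sup => _ [y _ <-]; rewrite /= rnorm0 lee_fin ler01.
Qed.

Lemma variation_ge0 (mu : set Omega -> K^o) E : (0 <= variation s mu E)%E.
Proof.
apply: ereal_sup_ubound; exists 0%N, (fun=> set0).
by split; [case|apply/trivIsetP => -[]|case|rewrite big_ord0].
Qed.

Lemma semivariation_eq0 E : semivariation s nu E = 0%E <->
  forall y', dual_ball s Y y' ->
    forall F, measurable F -> F `<=` E -> y' (nu F) = 0.
Proof.
split=> [E0 y' y'1 F mF FE|E0].
  apply: rnorm_eq0; apply/eqP; rewrite eq_le rnorm_ge0 andbT -lee_fin.
  rewrite (_ : 0%:E = semivariation s nu E)//.
  apply: (@le_trans _ _ (variation s (scalar_measure nu y') E)); last first.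
    by apply: ereal_sup_ubound; exists y'.
  apply: ereal_sup_ubound; exists 1%N, (fun=> F); split => //.
    by apply/trivIsetP => i j _ _; rewrite !ord1 eqxx.
  by rewrite big_ord1.
apply/eqP; rewrite eq_le; apply/andP; split.
  apply: ge_ereal_sup => _ [y' y'1 <-].
  apply: ge_ereal_sup => _ [n [A [mA _ AE ->]]].
  by rewrite big1// => i _; rewrite /scalar_measure (E0 y')// rnorm0.
apply: (le_trans (variation_ge0 (scalar_measure nu \0) E)).
by apply: ereal_sup_ubound; exists \0 => //; exact: dual_ball0.
Qed.

Lemma semivariation_set0 : semivariation s nu set0 = 0%E.
Proof.
apply/semivariation_eq0 => y' _ F _; rewrite subset0 => ->.
by rewrite vector_measure0 linear0.
Qed.

Lemma semivariation_setU0 A B : measurable A -> measurable B ->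
  semivariation s nu A = 0%E -> semivariation s nu B = 0%E ->
  semivariation s nu (A `|` B) = 0%E.
Proof.
move=> mA mB /semivariation_eq0 A0 /semivariation_eq0 B0.
apply/semivariation_eq0 => y' y'1 F mF FAB.
have mFA := measurableI _ _ mF mA; have mFDA := measurableD mF mA.
rewrite -(setUIDK F A) vector_measureU//; last first.
  by rewrite setDE setIACA setICr setI0.
rewrite linearD (A0 y')// (B0 y') ?addr0//.
by move=> w [/FAB[]].
Qed.

Lemma semivariation_aeT (P : Omega -> Prop) :
  (forall w, P w) -> \forall w \ae semivariation s nu, P w.
Proof.
move=> PT; exists set0; split => //; first exact: semivariation_set0.
by move=> w; apply; exact: PT.
Qed.

Lemma semivariation_aeS2 (P Q S : Omega -> Prop) :
  (forall w, P w -> Q w -> S w) ->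
  (\forall w \ae semivariation s nu, P w) ->
  (\forall w \ae semivariation s nu, Q w) ->
  \forall w \ae semivariation s nu, S w.
Proof.
move=> PQS [A [mA A0 PA]] [B [mB B0 QB]]; exists (A `|` B); split.
- exact: measurableU.
- exact: semivariation_setU0.
- move=> w nS; apply: contrapT => /not_orP[nA nB]; apply: nS.
  by apply: PQS; apply: contrapT => n; [apply: nA; apply: PA|apply: nB; apply: QB].
Qed.

End null_sets.

Section ae_classes.
Context d (Omega : measurableType d) (R : realType) (K : numFieldType).
Context (s : scalar_field R K) (X Y : normedModType K).
Variable nu : vector_measure Omega Y.

Definition null_fun : {pred (Omega -> X)} :=
  fun f => `[< \forall w \ae semivariation s nu, f w = 0 >].

Lemma null_fun_submod_closed : submod_closed null_fun.
Proof.
split=> [|a f g]; rewrite !unfold_in; first exact/asboolP/semivariation_aeT.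
move=> /asboolP f0 /asboolP g0; apply/asboolP.
apply: semivariation_aeS2 f0 g0 => w fw gw.
by rewrite !fctE fw gw scaler0 addr0.
Qed.

HB.instance Definition _ := GRing.isSubmodClosed.Build K (Omega -> X) null_fun
  null_fun_submod_closed.

(* All functions [Omega -> X] modulo equality almost everywhere; the spaces
   [Lp] and [Lpw] below are subsets of this vector space. *)
Definition ae_class := Quotient.quot null_fun.
HB.instance Definition _ := GRing.Zmodule.on ae_class.
HB.instance Definition _ := EqQuotient.on ae_class.

Definition ae_class_of (f : Omega -> X) : ae_class :=
  (\pi_ae_class f)%qT.

Lemma ae_class_ofP (f g : Omega -> X) :
  ae_class_of f = ae_class_of g <-> \forall w \ae semivariation s nu, f w = g w.
Proof.
split=> [/eqP|fg].
  rewrite /ae_class_of -Quotient.idealrBE => /asboolP fg.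
  by apply: (semivariation_aeS2 _ fg fg) => w /eqP + _; rewrite !fctE subr_eq0 => /eqP.
apply/eqP; rewrite /ae_class_of -Quotient.idealrBE; apply/asboolP.
by apply: (semivariation_aeS2 _ fg fg) => w fgw _; rewrite !fctE fgw subrr.
Qed.

Lemma ae_class_ofD f g : ae_class_of (f + g) = ae_class_of f + ae_class_of g.
Proof. exact: (@Quotient.pi_add _ null_fun). Qed.

Definition scale_class (a : K) (u : ae_class) : ae_class :=
  ae_class_of (a *: repr u).

Lemma ae_class_ofZ a f : ae_class_of (a *: f) = scale_class a (ae_class_of f).
Proof.
apply/eqP; rewrite /scale_class /ae_class_of -Quotient.idealrBE -scalerBr rpredZ//.
by rewrite Quotient.idealrBE reprK.
Qed.

Lemma ae_class_of_repr (u : ae_class) : ae_class_of (repr u) = u.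
Proof. exact: reprK. Qed.

Fact scale_classA a b u :
  scale_class a (scale_class b u) = scale_class (a * b) u.
Proof. by rewrite -[u]ae_class_of_repr -!ae_class_ofZ scalerA. Qed.

Fact scale_class1 : left_id 1 scale_class.
Proof. by move=> u; rewrite -[u]ae_class_of_repr -ae_class_ofZ scale1r. Qed.

Fact scale_classDr : right_distributive scale_class +%R.
Proof.
move=> a u v; rewrite -[u]ae_class_of_repr -[v]ae_class_of_repr.
by rewrite -ae_class_ofD -!ae_class_ofZ scalerDr ae_class_ofD.
Qed.

Fact scale_classDl u : {morph scale_class^~ u : a b / a + b}.
Proof.
move=> a b /=; rewrite -[u]ae_class_of_repr -!ae_class_ofZ scalerDl.
exact: ae_class_ofD.
Qed.

HB.instance Definition _ := GRing.Zmodule_isLmodule.Build K ae_class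
  scale_classA scale_class1 scale_classDr scale_classDl.

Variable p : R.

Definition Lpw : set ae_class := [set ae_class_of f | f in Lpw_fun s nu p].

Definition Lp : set ae_class := [set ae_class_of f | f in Lp_fun s nu p].

(* does not depend on the representative, and is finite on [Lpw] *)
Definition Lpw_norm (u : ae_class) : \bar R := Lpw_norm_fun s nu p (repr u).

End ae_classes.
Arguments ae_class {d Omega R K} s X {Y} nu.
Arguments Lpw {d Omega R K} s X {Y} nu p _.
Arguments Lp {d Omega R K} s X {Y} nu p _.

(* [A] is closed in [S] for the distance [N (u - v)] *)
Definition norm_closed_in (R : realType) (V : zmodType) (N : V -> \bar R)
    (S A : set V) : Prop :=
  forall u, S u ->
    (forall e : R, 0 < e -> exists2 v, A v & (N (u - v)%R < e%:E)%E) -> A u.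

(* Main.v *)
(* The variation of the scalar measure [y' o nu] is a finite positive measure:
   its real and imaginary parts are signed measures, which Hahn's decomposition
   bounds.  A strongly measurable [f] has [|f|] equal to a measurable function off
   a null set, so Minkowski's inequality for each [|y' o nu|] makes the norm
   subadditive.  Thus [Lp] is the set of norm limits of simple functions: it is a
   vector space, a diagonal argument makes it closed, and since simple functions
   have finite norm it is contained in [Lpw]; functionals outside the dual ball
   are multiples of functionals in it. *)

Require Import Defs.
From HB Require Import structures.
From mathcomp Require Import all_boot all_order all_algebra.
From mathcomp Require Import complex.
From mathcomp Require Import all_classical all_reals all_analysis.
From mathcomp Require Import measurable_realfun.

Set Implicit Arguments.
Unset Strict Implicit.
Unset Printing Implicit Defensive.

Import Order.TTheory GRing.Theory Num.Theory.
Import numFieldNormedType.Exports.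

Local Open Scope classical_set_scope.
Local Open Scope ring_scope.

(** * Real-valued norms over a real or complex scalar field *)

Section scalar_field.
Context (R : realType) (K : numFieldType).
Variable s : scalar_field R K.

(** The embedding of the reals in [K]. It preserves and reflects the order, so inequalities between
    norms in [K] are carried over to [rnorm]. *)
Definition real_scalar : R -> K :=
  match s in scalar_field _ K return R -> K with
  | RealScalars => id
  | ComplexScalars => @real_complex R
  end.

Lemma ler_real_scalar (a b : R) : (real_scalar a <= real_scalar b) = (a <= b).
Proof. by rewrite /real_scalar; case: K / s => //; rewrite lecR. Qed.

Lemma ltr_real_scalar (a b : R) : (real_scalar a < real_scalar b) = (a < b).
Proof. by rewrite /real_scalar; case: K / s => //; rewrite ltcR. Qed.

Lemma real_scalar0 : real_scalar 0 = 0.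
Proof. by rewrite /real_scalar; case: K / s. Qed.

Lemma real_scalar1 : real_scalar 1 = 1.
Proof. by rewrite /real_scalar; case: K / s. Qed.

Lemma real_scalarD : {morph real_scalar : a b / a + b}.
Proof. by rewrite /real_scalar; case: K / s => // a b /=; rewrite rmorphD. Qed.

Lemma real_scalarM : {morph real_scalar : a b / a * b}.
Proof. by rewrite /real_scalar; case: K / s => // a b /=; rewrite rmorphM. Qed.

Lemma real_scalar_inj : injective real_scalar.
Proof. by rewrite /real_scalar; case: K / s => //; exact: complexI. Qed.

Lemma normr_real_scalar (V : normedModType K) (v : V) :
  `|v| = real_scalar (rnorm s v).
Proof.
rewrite /real_scalar /rnorm; case: K / s V v => V v //=.
(* In the order of the complex numbers, being nonnegative includes having imaginary part zero. *)
have := normr_ge0 v; case: (`|v|) => a b.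
by rewrite lecE /= => /andP[/eqP -> _].
Qed.

Lemma rnorm_real_scalar (a : R) : 0 <= a -> rnorm s (real_scalar a : K^o) = a.
Proof.
move=> a0; apply: real_scalar_inj; rewrite -normr_real_scalar ger0_norm//.
by rewrite -real_scalar0 ler_real_scalar.
Qed.

Lemma ler_rnormD (V : normedModType K) (v w : V) :
  rnorm s (v + w) <= rnorm s v + rnorm s w.
Proof.
rewrite -ler_real_scalar real_scalarD -!normr_real_scalar; exact: ler_normD.
Qed.

Lemma rnormZ (V : normedModType K) (a : K) (v : V) :
  rnorm s (a *: v) = rnorm s (a : K^o) * rnorm s v.
Proof.
apply: real_scalar_inj.
by rewrite real_scalarM -!normr_real_scalar normrZ.
Qed.

Lemma rnormN (V : normedModType K) (v : V) : rnorm s (- v) = rnorm s v.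
Proof. by rewrite /rnorm normrN. Qed.

Lemma rnormB (V : normedModType K) (v w : V) :
  rnorm s (v - w) = rnorm s (w - v).
Proof. by rewrite -rnormN opprB. Qed.

Lemma ler_rnorm_sum (V : normedModType K) I (r : seq I) (P : pred I)
    (F : I -> V) :
  rnorm s (\sum_(i <- r | P i) F i) <= \sum_(i <- r | P i) rnorm s (F i).
Proof.
elim/big_ind2 : _ => //; first by rewrite rnorm0.
by move=> x a y b xa yb; rewrite (le_trans (ler_rnormD _ _))// lerD.
Qed.

(** The radii of balls in [V] are positive elements of [K]. Such an element equals its own norm,
    hence is the image of a positive real, so both sides use the same radii. *)
Lemma cvg_rnormB (V : normedModType K) T (F : set_system T) {FF : Filter F}
    (f : T -> V) (l : V) :
  f x @[x --> F] --> l <-> rnorm s (f x - l) @[x --> F] --> (0 : R).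
Proof.
split=> [fl|].
  apply/cvgrPdist_lt => e e0.
  have e0' : 0 < real_scalar e by rewrite -real_scalar0 ltr_real_scalar.
  near=> x; rewrite sub0r normrN ger0_norm ?rnorm_ge0// rnormB.
  rewrite -ltr_real_scalar -normr_real_scalar.
  by near: x; exact: cvgr_dist_lt.
move=> fl; apply/cvgrPdist_lt => e e0.
have [r r0 re] : exists2 r, 0 < r & real_scalar r = e.
  exists (rnorm s (e : K^o)); last by rewrite -normr_real_scalar gtr0_norm.
  by rewrite -ltr_real_scalar -normr_real_scalar real_scalar0 normr_gt0 gt_eqF.
near=> x; rewrite -re normr_real_scalar ltr_real_scalar rnormB.
rewrite -[ltLHS]ger0_norm ?rnorm_ge0// -[X in `|X|]opprK normrN -sub0r.
by near: x; apply: cvgr_dist_lt.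
Unshelve. all: by end_near. Qed.

Lemma cvg_rnorm (V : normedModType K) T (F : set_system T) {FF : Filter F}
    (f : T -> V) (l : V) :
  f x @[x --> F] --> l -> rnorm s (f x) @[x --> F] --> rnorm s l.
Proof.
move=> /cvg_rnormB fl; apply/cvgrPdist_lt => e e0.
near=> x; apply: (@le_lt_trans _ _ (rnorm s (f x - l))); last first.
  rewrite -[ltLHS]ger0_norm ?rnorm_ge0// -[X in `|X|]opprK normrN -sub0r.
  by near: x; apply: cvgr_dist_lt.
(* The reverse triangle inequality, one half at a time. *)
rewrite ler_distl lerBlDl; apply/andP; split.
  by rewrite -{1}(subrK l (f x)) ler_rnormD.
by rewrite addrC rnormB -{1}(subrK (f x) l) ler_rnormD.
Unshelve. all: by end_near. Qed.

End scalar_field.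

(** * Finiteness of the variation of a scalar measure *)

(** The coordinates are the real and imaginary parts, or the identity and zero for real scalars.
    They reduce a scalar measure to two signed measures. *)
Lemma scalar_coordinates (R : realType) (K : numFieldType)
    (s : scalar_field R K) : exists phi psi : K -> R,
  [/\ {morph phi : x y / x - y}, {morph psi : x y / x - y},
      forall z, `|phi z| <= rnorm s (z : K^o),
      forall z, `|psi z| <= rnorm s (z : K^o) &
      forall z, rnorm s (z : K^o) <= `|phi z| + `|psi z|].
Proof.
rewrite /rnorm; case: K / s => /=.
  exists id, (fun=> 0); split => //.
  - by move=> x y /=; rewrite subr0.
  - by move=> z; rewrite normr0.
  - by move=> z; rewrite normr0 addr0.
have Re_norm (z : R[i]) : complex.Re `|z : R[i]^o| =
    Num.sqrt (complex.Re z ^+ 2 + complex.Im z ^+ 2) by case: z.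
exists (@complex.Re R), (@complex.Im R); split.
- by move=> [a b] [c e].
- by move=> [a b] [c e].
- by move=> z; rewrite [leRHS]Re_norm -sqrtr_sqr ler_wsqrtr ?lerDl ?sqr_ge0.
- by move=> z; rewrite [leRHS]Re_norm -sqrtr_sqr ler_wsqrtr ?lerDr ?sqr_ge0.
(* Both sides are square roots, and the square of the sum exceeds the sum of squares by a
   nonnegative cross term. *)
- move=> z; rewrite [leLHS]Re_norm -[leRHS]ger0_norm ?addr_ge0// -sqrtr_sqr.
  apply: ler_wsqrtr; rewrite sqrrD !real_normK ?num_real//.
  by rewrite addrAC lerDl mulrn_wge0// mulr_ge0.
Qed.

Section variation_finite.
Context d (Omega : measurableType d) (R : realType) (K : numFieldType).
Variable s : scalar_field R K.
Variable mu : vector_measure Omega K^o.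
Local Open Scope ereal_scope.

(** Composing [mu] with [phi] gives a finite signed measure. Its total variation over the whole
    space, obtained from a Hahn decomposition, is the uniform bound. *)
Lemma coordinate_variation_finite (phi : K -> R) :
  {morph phi : x y / (x - y)%R} ->
  (forall z, (`|phi z| <= rnorm s (z : K^o))%R) ->
  exists2 c : \bar R, c < +oo & forall n (A : 'I_n -> set Omega),
    (forall i, measurable (A i)) -> trivIset setT A ->
    \sum_(i < n) `|phi (mu (A i))|%:E <= c.
Proof.
move=> phiB phi_le.
have phi0 : phi 0%R = 0%R by rewrite -(subrr 0%R) phiB subrr.
have phiN x : phi (- x)%R = (- phi x)%R by rewrite -sub0r phiB phi0 sub0r.
have phiD x y : phi (x + y)%R = (phi x + phi y)%R.
  by rewrite -[in LHS](opprK y) phiB phiN opprK.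
pose nu A := (phi (mu A))%:E.
have nu0 : nu set0 = 0 by rewrite /nu vector_measure0 phi0.
have nufin A : d.-measurable A -> nu A \is a fin_num by [].
have nusa : semi_sigma_additive nu.
  move=> F mF tF _.
  rewrite (_ : (fun n => _) =
    EFin \o (fun n => phi (\sum_(0 <= i < n) mu (F i))%R)); last first.
    apply/funext => n /=; elim/big_ind2 : _ => //; first by rewrite phi0.
    by move=> x a y b -> ->; rewrite phiD.
  apply: cvg_EFin; first exact: nearW.
  have /(cvg_rnormB s) h := @vector_measure_sigma_additive _ _ _ _ mu _ mF tF.
  (* [phi] is additive and 1-Lipschitz, so it carries the convergence of the partial sums of [mu] to
     the reals. *)
  apply/cvgrPdist_lt => e e0; near=> n.
  rewrite -phiB (le_lt_trans (phi_le _))// rnormB.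
  rewrite -[ltLHS]ger0_norm ?rnorm_ge0// -[X in `|X|%R]opprK normrN -sub0r.
  by near: n; apply: cvgr_dist_lt.
pose m : {charge set Omega -> \bar R} :=
  HB.pack nu (isCharge.Build _ _ _ nu nu0 nufin nusa).
have [P [N PN]] := Hahn_decomposition m.
exists (charge_variation PN setT).
  by rewrite ltey_eq fin_num_measure.
move=> n A mA tA.
apply: (@le_trans _ _ (\sum_(i < n) charge_variation PN (A i))).
  by apply: lee_sum => i _; have := abse_charge_variation PN (mA i).
rewrite -measure_bigsetU_ord//; apply: le_measure; rewrite ?inE//.
exact: bigsetU_measurable.
Unshelve. all: by end_near. Qed.

Lemma variation_finite E : Defs.variation s mu E < +oo.
Proof.
have [phi [psi [phiB psiB phi_le psi_le le_phi_psi]]] := scalar_coordinates s.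
have [c coo hc] := coordinate_variation_finite phiB phi_le.
have [c' c'oo hc'] := coordinate_variation_finite psiB psi_le.
apply: (@le_lt_trans _ _ (c + c')); last exact: lte_add_pinfty.
apply: ge_ereal_sup => _ [n [A [mA tA _ ->]]].
apply: le_trans (leeD (hc _ _ mA tA) (hc' _ _ mA tA)).
by rewrite -big_split; apply: lee_sum => i _; rewrite lee_fin.
Qed.

End variation_finite.

(** * The variation as a measure *)

Section variation_measure.
Context d (Omega : measurableType d) (R : realType) (K : numFieldType).
Variable s : scalar_field R K.
Local Open Scope ereal_scope.

Lemma variation_set0 (mu : vector_measure Omega K^o) :
  Defs.variation s mu set0 = 0.
Proof.
apply/eqP; rewrite eq_le Defs.variation_ge0 andbT.
apply: ge_ereal_sup => _ [n [A [_ _ A0 ->]]].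
rewrite big1// => i _; rewrite (_ : A i = set0) ?vector_measure0 ?rnorm0//.
by apply/seteqP; split => // w /A0.
Qed.

Lemma le_variation (mu : set Omega -> K^o) E F :
  E `<=` F -> Defs.variation s mu E <= Defs.variation s mu F.
Proof.
move=> EF; apply: ge_ereal_sup => _ [n [A [mA tA AE ->]]].
apply: ereal_sup_ubound; exists n, A; split => // i w /AE; exact: EF.
Qed.

Variable mu : vector_measure Omega K^o.

(** The triangle inequality for partial sums, passed to the limit. *)
Lemma rnorm_vector_measure_bigcup (A : (set Omega)^nat) :
  (forall i, measurable (A i)) -> trivIset setT A ->
  (rnorm s (mu (\bigcup_i A i)))%:E <= \sum_(0 <= i <oo) (rnorm s (mu (A i)))%:E.
Proof.
move=> mA tA.
have h : (rnorm s (\sum_(0 <= i < n) mu (A i))%R)%:E @[n --> \oo] -->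
    (rnorm s (mu (\bigcup_i A i)))%:E.
  apply/fine_cvgP; split; first exact: nearW.
  apply: cvg_rnorm; exact: (@vector_measure_sigma_additive _ _ _ _ mu _ mA tA).
rewrite -(cvg_lim _ h)//; apply: lee_lim.
- exact: cvgP h.
- by apply: is_cvg_nneseries => i _ _; rewrite lee_fin rnorm_ge0.
- by apply: nearW => n /=; rewrite sumEFin lee_fin ler_rnorm_sum.
Qed.

(** A disjoint family in [E] followed by one in [F] is a disjoint family in the union. Since
    variations are finite, subtraction allows the two suprema to be treated one after the other. *)
Lemma variation_superadditive E F : E `&` F = set0 ->
  Defs.variation s mu E + Defs.variation s mu F <= Defs.variation s mu (E `|` F).
Proof.
move=> EF0.
have vfin G : Defs.variation s mu G \is a fin_num.
  by rewrite ge0_fin_numE ?Defs.variation_ge0// variation_finite.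
rewrite -leeBrDr//; apply: ge_ereal_sup => _ [n [A [mA tA AE ->]]].
rewrite leeBrDr// -leeBrDl ?sumEFin//; apply: ge_ereal_sup => _ [m [B [mB tB BF ->]]].
rewrite leeBrDl// -sumEFin; apply: ereal_sup_ubound.
pose C (i : 'I_(n + m)) := match fintype.split i with inl j => A j | inr j => B j end.
exists (n + m)%N, C; split.
- by move=> i; rewrite /C; case: fintype.split.
- have AB i j w : A i w -> B j w -> False.
    by move=> /AE Ew /BF Fw; have : (E `&` F) w by []; rewrite EF0.
  move=> i j _ _ [w []]; rewrite /C.
  case: (splitP i) => k ik; case: (splitP j) => l jl.
  + move=> Ak Al; apply: val_inj; rewrite /= ik jl; congr nat_of_ord.
    by apply: tA => //; exists w.
  + by move=> Ak Bl; case: (AB k l w).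
  + by move=> Bk Al; case: (AB l k w).
  + move=> Bk Bl; apply: val_inj; rewrite /= ik jl; congr (n + nat_of_ord _)%N.
    by apply: tB => //; exists w.
- move=> i w; rewrite /C.
  by case: fintype.split => j; [move=> /AE; left|move=> /BF; right].
- rewrite big_split_ord /=; congr (_ + _); apply: eq_bigr => i _; rewrite /C.
    by rewrite (unsplitK (inl i)).
  by rewrite (unsplitK (inr i)).
Qed.

(** For one inequality, a family in the union is cut along the sets [F j]; for the other, finite
    superadditivity and monotonicity bound every partial sum. *)
Lemma variation_semi_sigma_additive :
  semi_sigma_additive (Defs.variation s mu : set Omega -> \bar R).
Proof.
move=> F mF tF mUF.
(* A series of nonnegative terms converges to its sum, so an equality is enough. *)
suff -> : Defs.variation s mu (\bigcup_i F i) =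
    \sum_(0 <= i <oo) Defs.variation s mu (F i).
  by apply: is_cvg_nneseries => i _ _; exact: Defs.variation_ge0.
apply/eqP; rewrite eq_le; apply/andP; split.
  apply: ge_ereal_sup => _ [n [A [mA tA AF ->]]].
  apply: (@le_trans _ _ (\sum_(i < n) \sum_(0 <= j <oo)
      (rnorm s (mu (A i `&` F j)))%:E)).
    apply: lee_sum => i _.
    have {1}-> : A i = \bigcup_j (A i `&` F j).
      by rewrite -setI_bigcupr; apply/esym/setIidPl/AF.
    apply: rnorm_vector_measure_bigcup.
    - by move=> j; exact: measurableI.
    - exact: trivIset_setIl.
  (* After exchanging the sums, the term of index [j] comes from the family of the [A i] cut by
     [F j], which competes in the variation of [F j]. *)
  rewrite -nneseries_sum; last by move=> i j _; rewrite lee_fin rnorm_ge0.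
  apply: lee_nneseries => j _.
    by move=> _; apply: sume_ge0 => i _; rewrite lee_fin rnorm_ge0.
  apply: ereal_sup_ubound; exists n, (fun i => A i `&` F j); split => //.
  - by move=> i; exact: measurableI.
  - exact: trivIset_setIr.
apply: lime_le; first by apply: is_cvg_nneseries => i _ _; exact: Defs.variation_ge0.
apply: nearW => n.
apply: (@le_trans _ _
    (Defs.variation s mu (\big[setU/set0]_(0 <= i < n) F i))).
  elim: n => [|n ih]; first by rewrite !big_nil variation_set0.
  rewrite !big_nat_recr//=.
  apply: le_trans (variation_superadditive _); first by rewrite leeD2r.
  rewrite big_mkord; apply: (@trivIset_bigsetUI _ xpredT) => //.
  exact: sub_trivIset tF.
apply: le_variation; rewrite big_mkord; exact: bigsetU_bigcup.
Qed.

HB.instance Definition _ := isMeasure.Build d Omega R (Defs.variation s mu)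
  (variation_set0 mu) (Defs.variation_ge0 s mu) variation_semi_sigma_additive.

End variation_measure.

(** * Comparison of integrals off a null set, without measurability of the integrands *)

Section integral_off_null_sets.
Context d (T : measurableType d) (R : realType).
Variable m : {measure set T -> \bar R}.
Local Open Scope ereal_scope.
Import HBNNSimple.

(* A simple function below [f] becomes a simple function below [g] once it is
   set to zero on [N]. *)
Lemma ge0_le_integral_off_null (N : set T) (f g : T -> \bar R) :
  measurable N -> m N = 0 ->
  (forall x, 0 <= f x) -> (forall x, 0 <= g x) ->
  (forall x, ~ N x -> f x <= g x) ->
  \int[m]_x f x <= \int[m]_x g x.
Proof.
move=> mN N0 f0 g0 fg.
rewrite ge0_integralTE//; apply: ge_ereal_sup => _ [h hf <-].
pose h' := proj_nnsfun h (measurableC mN).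
have h'E x : (h' x)%:E = (h x * \1_(~` N) x)%:E by [].
rewrite -integralT_nnsfun (_ : \int[m]_x (h x)%:E = \int[m]_x (h' x)%:E).
  rewrite integralT_nnsfun ge0_integralTE//; apply: ereal_sup_ubound.
  exists h' => // x; rewrite h'E indicE; case: (pselect (N x)) => Nx.
    by rewrite memNset ?mulr0//; apply; exact: Nx.
  by rewrite mem_set// mulr1 (le_trans (hf x))// fg.
apply: ge0_ae_eq_integral => //.
- by apply/measurable_EFinP.
- by apply/measurable_EFinP.
- by move=> x _; rewrite lee_fin.
- by move=> x _; rewrite lee_fin.
exists N; split => // x /= hx; apply: contrapT => Nx; apply: hx => _.
by rewrite h'E indicE mem_set ?mulr1.
Qed.

End integral_off_null_sets.

(** * The scalar measures obtained from continuous functionals *)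

Section scalar_measures.
Context d (Omega : measurableType d) (R : realType) (K : numFieldType).
Context (s : scalar_field R K) (Y : normedModType K).
Variable nu : vector_measure Omega Y.

Lemma scalar_measure_sigma_additive (y' : {linear Y -> K^o}) : continuous y' ->
  forall A : (set Omega)^nat, (forall i, measurable (A i)) -> trivIset setT A ->
  (fun n => \sum_(0 <= i < n) scalar_measure nu y' (A i)) @ \oo -->
    scalar_measure nu y' (\bigcup_i A i).
Proof.
move=> y'c A mA tA; rewrite /scalar_measure.
under eq_fun do rewrite -linear_sum.
have h := @vector_measure_sigma_additive _ _ _ _ nu _ mA tA.
exact: (cvg_comp (fun n => \sum_(0 <= i < n) nu (A i)) y' h (y'c _)).
Qed.

(** The set function [scalar_measure nu y'] bundled with its sigma-additivity, so that its variation
    is recognised as a measure and integration theory applies to it. *)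
Definition scalar_vector_measure (y' : {linear Y -> K^o}) (y'c : continuous y') :
  vector_measure Omega K^o :=
  @VectorMeasure _ _ _ _ _ (scalar_measure_sigma_additive y'c).

(** Dividing [y'] by a positive operator bound [M] gives [z'], and [r] is [M] as a real number. This
    reduces statements about continuous functionals to the dual ball. *)
Lemma continuous_dual_ball (y' : {linear Y -> K^o}) : continuous y' ->
  exists (r : R) (z' : {linear Y -> K^o}), [/\ 0 < r, dual_ball s Y z' &
    forall y, y' y = real_scalar s r *: z' y].
Proof.
move=> /linear_bounded_continuous/linear_boundedP/pinfty_ex_gt0[M M0 y'M].
have rM : real_scalar s (rnorm s (M : K^o)) = M.
  by rewrite -normr_real_scalar gtr0_norm.
exists (rnorm s (M : K^o)), (M^-1 \*: y'); split.
- by rewrite -(ltr_real_scalar s) rM real_scalar0.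
- have z'M y : `|M^-1 *: y' y| <= `|y|.
    by rewrite normrZ normfV gtr0_norm// ler_pdivrMl.
  split.
    apply/linear_bounded_continuous/linear_boundedP; near=> k => y /=.
    by rewrite (le_trans (z'M y))// ler_peMl//; near: k; exact: nbhs_pinfty_ge.
  apply: ge_ereal_sup => _ [y /= y1 <-]; rewrite lee_fin (le_trans _ y1)//.
  by rewrite -(ler_real_scalar s) -!normr_real_scalar.
- by move=> y /=; rewrite rM scalerA divff ?scale1r// gt_eqF.
Unshelve. all: by end_near. Qed.

(** The semivariation only tests functionals of the dual ball; a general [y'] is a multiple of one
    of them. *)
Lemma variation_eq0 (y' : {linear Y -> K^o}) (N : set Omega) : continuous y' ->
  measurable N -> semivariation s nu N = 0%E ->
  Defs.variation s (scalar_measure nu y') N = 0%E.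
Proof.
move=> /continuous_dual_ball[r [z' [r0 z'1 y'z']]] mN /semivariation_eq0 N0.
apply/eqP; rewrite eq_le Defs.variation_ge0 andbT.
apply: ge_ereal_sup => _ [n [A [mA _ AN ->]]]; rewrite big1// => i _.
by rewrite /scalar_measure y'z' (N0 z')// scaler0 rnorm0.
Qed.

Lemma le_variationZ (mu mu' : set Omega -> K^o) (r : R) E : 0 <= r ->
  (forall A, mu A = real_scalar s r *: mu' A) ->
  (Defs.variation s mu E <= r%:E * Defs.variation s mu' E)%E.
Proof.
move=> r0 mumu'; apply: ge_ereal_sup => _ [n [A [mA tA AE ->]]].
apply: (@le_trans _ _ (r%:E * \sum_(i < n) (rnorm s (mu' (A i)))%:E)%E).
  rewrite !sumEFin -EFinM lee_fin mulr_sumr ler_sum// => i _.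
  by rewrite mumu' rnormZ rnorm_real_scalar.
by rewrite lee_wpmul2l ?lee_fin//; apply: ereal_sup_ubound; exists n, A.
Qed.

End scalar_measures.

(** * Simple and strongly measurable functions *)

Section simple_functions.
Context d (Omega : measurableType d) (R : realType) (K : numFieldType).
Context (s : scalar_field R K) (X : normedModType K).
Implicit Types f g : Omega -> X.

Lemma simple_function0 : simple_function (fun _ : Omega => 0 : X).
Proof.
exists 0%N, (fun=> set0), (fun=> 0); split; first by case.
by apply/funext => w; rewrite big_ord0.
Qed.

Lemma simple_functionD f g :
  simple_function f -> simple_function g -> simple_function (f + g).
Proof.
move=> [n [A [x [mA ->]]]] [m [B [y [mB ->]]]].
exists (n + m)%N,
  (fun i => match fintype.split i with inl j => A j | inr j => B j end),
  (fun i => match fintype.split i with inl j => x j | inr j => y j end).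
split; first by move=> i; case: fintype.split.
apply/funext => w; rewrite big_split_ord /= fctE.
congr (_ + _); apply: eq_bigr => i _.
  by rewrite (unsplitK (inl i)).
by rewrite (unsplitK (inr i)).
Qed.

Lemma simple_functionZ (a : K) f : simple_function f -> simple_function (a *: f).
Proof.
move=> [n [A [x [mA ->]]]]; exists n, A, (fun i => a *: x i); split => //.
apply/funext => w; rewrite fctE scaler_sumr; apply: eq_bigr => i _.
by rewrite !scalerA mulrC.
Qed.

(** [phi] is arbitrary because a simple function takes finitely many values. The induction on the
    number of terms is over all [phi] at once: on the last set, the last term is absorbed into [phi]
    as a translation. *)
Lemma simple_function_measurable_comp (phi : X -> R) f :
  simple_function f -> measurable_fun setT (phi \o f).
Proof.
move=> [n [A [x [mA ->]]]]; elim: n A x mA phi => [|n ih] A x mA phi.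
  rewrite [X in measurable_fun _ X](_ : _ = cst (phi 0)).
    exact: measurable_cst.
  by apply/funext => w /=; rewrite big_ord0.
pose g w := \sum_(i < n)
  (\1_(A (widen_ord (leqnSn n) i)) w : K) *: x (widen_ord (leqnSn n) i).
rewrite [X in measurable_fun _ X](_ : _ = fun w =>
    if w \in A ord_max then phi (g w + x ord_max) else phi (g w)).
  apply: measurable_fun_ifT => /=.
  - apply: (measurable_fun_bool true); rewrite setTI.
    rewrite (_ : _ @^-1` _ = A ord_max)//.
    by apply/seteqP; split => w /=; [move/set_mem|move/mem_set].
  - exact: (ih _ _ _ (fun z => phi (z + x ord_max))).
  - exact: (ih _ _ _ phi).
apply/funext => w /=; rewrite big_ord_recr /= indicE.
by case: ifPn => _; rewrite ?scale1r ?scale0r ?addr0.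
Qed.

Lemma simple_function_bounded f : simple_function f ->
  exists c : R, forall w, rnorm s (f w) <= c.
Proof.
move=> [n [A [x [mA ->]]]]; exists (\sum_(i < n) rnorm s (x i)) => w.
rewrite (le_trans (ler_rnorm_sum _ _ _ _))// ler_sum// => i _.
rewrite rnormZ indicE; case: (_ \in _).
  by rewrite -(real_scalar1 s) rnorm_real_scalar ?mul1r.
by rewrite rnorm0 mul0r rnorm_ge0.
Qed.

Variables (Y : normedModType K) (nu : vector_measure Omega Y).

Lemma simple_function_strongly_measurable f :
  simple_function f -> strongly_measurable s nu f.
Proof.
move=> sf; exists (fun=> f); split => //; apply: semivariation_aeT => w.
exact: cvg_cst.
Qed.

Lemma strongly_measurableD f g : strongly_measurable s nu f ->
  strongly_measurable s nu g -> strongly_measurable s nu (f + g).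
Proof.
move=> [f_ [sf ff]] [g_ [sg gg]]; exists (fun n => f_ n + g_ n); split.
  by move=> n; exact: simple_functionD.
by apply: semivariation_aeS2 ff gg => w fw gw; exact: cvgD.
Qed.

Lemma strongly_measurableZ a f :
  strongly_measurable s nu f -> strongly_measurable s nu (a *: f).
Proof.
move=> [f_ [sf ff]]; exists (fun n => a *: f_ n); split.
  by move=> n; exact: simple_functionZ.
by apply: (semivariation_aeS2 _ ff ff) => w fw _; exact: cvgZr.
Qed.

Lemma strongly_measurableB f g : strongly_measurable s nu f ->
  strongly_measurable s nu g -> strongly_measurable s nu (f - g).
Proof.
move=> mf mg; rewrite -scaleN1r; apply: strongly_measurableD => //.
exact: strongly_measurableZ.
Qed.

(** [N] is a measurable null set containing the points where the approximating simple functions fail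
    to converge, and [a] is the norm of [f] set to zero on [N]. It is an everywhere limit of
    measurable functions, and stands in for the norm of [f] where measurability is required. *)
Lemma strongly_measurable_rnorm f : strongly_measurable s nu f ->
  exists N (a : Omega -> R), [/\ measurable N, semivariation s nu N = 0%E,
    measurable_fun setT a, forall w, 0 <= a w <= rnorm s (f w) &
    forall w, ~ N w -> a w = rnorm s (f w)].
Proof.
move=> [f_ [sf [N [mN N0 fN]]]].
pose cut (h : Omega -> X) w := \1_(~` N) w * rnorm s (h w).
have cutN h w : N w -> cut h w = 0.
  by move=> Nw; rewrite /cut indicE memNset ?mul0r//; apply; exact: Nw.
have cutC h w : ~ N w -> cut h w = rnorm s (h w).
  by move=> Nw; rewrite /cut indicE mem_set// mul1r.
exists N, (cut f); split => //; [|move=> w|exact: cutC]; last first.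
  case: (pselect (N w)) => Nw; first by rewrite cutN// lexx rnorm_ge0.
  by rewrite cutC// lexx rnorm_ge0.
apply: (@measurable_fun_cvg _ _ _ _ (fun n => cut (f_ n))).
  move=> n; apply: measurable_funM.
    exact/measurable_indic/measurableC.
  exact: (simple_function_measurable_comp (rnorm s (V:=X)) (sf n)).
move=> w _; case: (pselect (N w)) => Nw.
  by rewrite cutN//; under eq_fun do rewrite cutN//; exact: cvg_cst.
rewrite cutC//; under eq_fun do rewrite cutC//.
apply: cvg_rnorm; apply: contrapT => h; apply: Nw; exact: fN.
Qed.

End simple_functions.

(** * Integrals of powers of the norm, and the weak norm as their supremum *)

Section Lp_norm.
Context d (Omega : measurableType d) (R : realType) (K : numFieldType).
Context (s : scalar_field R K) (X Y : normedModType K).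
Variables (nu : vector_measure Omega Y) (p : R).
Hypothesis p_ge1 : 1 <= p.
Implicit Types f g : Omega -> X.
Local Open Scope ereal_scope.

Let p_gt0 : (0 < p)%R. Proof. exact: lt_le_trans p_ge1. Qed.

Let le_root (x y : \bar R) : 0 <= x -> x <= y -> x `^ p^-1 <= y `^ p^-1.
Proof.
move=> x0 xy; apply: gt0_ler_poweR => //; first by rewrite invr_ge0 ltW.
  by rewrite in_itv /= x0 leey.
by rewrite in_itv /= leey (le_trans x0).
Qed.

Lemma le_integral_powR (m : {measure set Omega -> \bar R}) (N : set Omega)
    (a b : Omega -> R) : measurable N -> m N = 0 ->
  (forall w, (0 <= a w)%R) -> (forall w, (0 <= b w)%R) ->
  (forall w, ~ N w -> (a w <= b w)%R) ->
  \int[m]_w (a w `^ p)%:E <= \int[m]_w (b w `^ p)%:E.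
Proof.
move=> mN N0 a0 b0 ab; apply: (ge0_le_integral_off_null mN N0).
- by move=> w; rewrite lee_fin powR_ge0.
- by move=> w; rewrite lee_fin powR_ge0.
move=> w Nw; rewrite lee_fin ge0_ler_powR ?nnegrE// ?ab//; exact: ltW.
Qed.

Lemma Lnorm_ge0E (m : {measure set Omega -> \bar R}) (a : Omega -> R) :
  (forall w, (0 <= a w)%R) ->
  'N[m]_p%:E [EFin \o a] = (\int[m]_w (a w `^ p)%:E) `^ p^-1.
Proof.
move=> a0; rewrite unlock; congr (_ `^ _); apply: eq_integral => w _ /=.
by rewrite ger0_norm// poweR_EFin.
Qed.

Section functional.
Variables (y' : {linear Y -> K^o}) (y'c : continuous y').

Let m : {measure set Omega -> \bar R} :=
  Defs.variation s (scalar_vector_measure nu y'c).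

Let null N : measurable N -> semivariation s nu N = 0 -> m N = 0.
Proof. exact: variation_eq0. Qed.

Lemma integral_normp_ge0 f : 0 <= integral_normp s nu p f y'.
Proof.
by apply: (@integral_ge0 _ _ _ m) => w _; rewrite lee_fin powR_ge0.
Qed.

Lemma le_integral_normp f g :
  (\forall w \ae semivariation s nu, (rnorm s (f w) <= rnorm s (g w))%R) ->
  integral_normp s nu p f y' <= integral_normp s nu p g y'.
Proof.
move=> [N [mN N0 fgN]].
apply: (le_integral_powR mN (null mN N0)) => [w|w|w Nw]; try exact: rnorm_ge0.
by apply: contrapT => h; apply: Nw; exact: fgN.
Qed.

(** Minkowski's inequality applies to measurable functions [a] and [b] that equal the norms of [f]
    and [g] off null sets. *)
Lemma integral_normp_triangle f g :
  strongly_measurable s nu f -> strongly_measurable s nu g ->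
  integral_normp s nu p (f + g)%R y' `^ p^-1 <=
  integral_normp s nu p f y' `^ p^-1 + integral_normp s nu p g y' `^ p^-1.
Proof.
move=> /strongly_measurable_rnorm[A [a [mA A0 ma a01 aA]]].
move=> /strongly_measurable_rnorm[B [b [mB B0 mb b01 bB]]].
have a0 w : (0 <= a w)%R by case/andP: (a01 w).
have b0 w : (0 <= b w)%R by case/andP: (b01 w).
apply: (@le_trans _ _ ('N[m]_p%:E [EFin \o a] + 'N[m]_p%:E [EFin \o b])).
  apply: le_trans (minkowski_EFin _ ma mb p_ge1).
  rewrite Lnorm_ge0E => [|w]; last by rewrite addr_ge0.
  apply: le_root; first exact: integral_normp_ge0.
  apply: (@le_integral_powR m (A `|` B)) => [|||w|w /not_orP[Aw Bw]].
  - exact: measurableU.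
  - by rewrite measureU0 ?null.
  - by move=> w; exact: rnorm_ge0.
  - by rewrite addr_ge0.
  - by rewrite /= aA// bB// ler_rnormD.
(* The way back from [a] and [b] to the norms uses domination at every point. *)
have le_cut (c : Omega -> R) h : (forall w, (0 <= c w <= rnorm s (h w))%R) ->
    'N[m]_p%:E [EFin \o c] <= integral_normp s nu p h y' `^ p^-1.
  move=> ch; have c0 w : (0 <= c w)%R by case/andP: (ch w).
  rewrite Lnorm_ge0E//; apply: le_root.
    by apply: integral_ge0 => w _; rewrite lee_fin powR_ge0.
  apply: (@le_integral_powR m set0) => // [w|w _]; first exact: rnorm_ge0.
  by case/andP: (ch w).
by apply: leeD; exact: le_cut.
Qed.

Lemma integral_normpZ_le (c : K) f : strongly_measurable s nu f ->
  integral_normp s nu p (c *: f) y' <=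
  (rnorm s (c : K^o) `^ p)%:E * integral_normp s nu p f y'.
Proof.
move=> /strongly_measurable_rnorm[A [a [mA A0 ma a01 aA]]].
have a0 w : (0 <= a w)%R by case/andP: (a01 w).
have c0 : (0 <= rnorm s (c : K^o))%R by exact: rnorm_ge0.
(* The constant is pulled out of the integral of the measurable [a], which is dominated by the norm
   of [f]. *)
apply: (@le_trans _ _ (\int[m]_w ((rnorm s (c : K^o) * a w) `^ p)%:E)).
  apply: (le_integral_powR mA (null mA A0)) => [w|w|w Aw].
  - exact: rnorm_ge0.
  - by rewrite mulr_ge0.
  - by rewrite aA// -rnormZ.
under eq_integral do rewrite powRM// EFinM.
rewrite ge0_integralZl//; first last.
- by rewrite lee_fin powR_ge0.
- by move=> w _; rewrite lee_fin powR_ge0.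
- by apply/measurable_EFinP; exact: measurableT_comp (measurable_powR p) ma.
apply: lee_wpmul2l; first by rewrite lee_fin powR_ge0.
apply: (@le_integral_powR m set0) => // [w|w _]; first exact: rnorm_ge0.
by case/andP: (a01 w).
Qed.

(** A bounded function is integrated against a finite measure. *)
Lemma integral_normp_simple f : simple_function f ->
  integral_normp s nu p f y' < +oo.
Proof.
move=> sf; have [c fc] := simple_function_bounded s sf.
apply: (@le_lt_trans _ _ (\int[m]_w (c `^ p)%:E)).
  apply: (@le_integral_powR m set0 _ (fun=> c)) => // w; first exact: rnorm_ge0.
  exact: le_trans (rnorm_ge0 _ _) (fc w).
rewrite integral_cst// lte_mul_pinfty// ?lee_fin ?powR_ge0//.
exact: variation_finite.
Qed.

End functional.

(** With [y'] equal to [r] times [z'] in the dual ball, the variation for [y'] is at most [r] times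
    the one for [z'], and the integrals compare likewise. *)
Lemma integral_normp_dual_ball f : strongly_measurable s nu f ->
  (forall y', dual_ball s Y y' -> integral_normp s nu p f y' < +oo) ->
  forall y' : {linear Y -> K^o}, continuous y' ->
    integral_normp s nu p f y' < +oo.
Proof.
move=> /strongly_measurable_rnorm[A [a [mA A0 ma a01 aA]]] foo y' y'c.
have a0 w : (0 <= a w)%R by case/andP: (a01 w).
have [r [z' [r0 [z'c z'1] y'z']]] := continuous_dual_ball s y'c.
pose m : {measure set Omega -> \bar R} :=
  Defs.variation s (scalar_vector_measure nu y'c).
pose m' : {measure set Omega -> \bar R} :=
  Defs.variation s (scalar_vector_measure nu z'c).
have map : measurable_fun setT (fun w => (a w `^ p)%:E).
  by apply/measurable_EFinP; exact: measurableT_comp (measurable_powR p) ma.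
apply: (@le_lt_trans _ _ (\int[m]_w (a w `^ p)%:E)).
  apply: (@le_integral_powR m A) => [|||w|w Aw] //; last by rewrite aA.
  - exact: variation_eq0.
  - by move=> w; exact: rnorm_ge0.
apply: (@le_lt_trans _ _ (\int[mscale (NngNum (ltW r0)) m']_w (a w `^ p)%:E)).
  apply: ge0_le_measure_integral => //.
    by move=> B mB; apply: le_variationZ => [|B']; [exact: ltW|exact: y'z'].
  by move=> w; rewrite lee_fin powR_ge0.
rewrite ge0_integral_mscale//; last by move=> w _; rewrite lee_fin powR_ge0.
rewrite lte_mul_pinfty// ?lee_fin ?(ltW r0)//.
apply: le_lt_trans (foo z' (conj z'c z'1)).
apply: (@le_integral_powR m' set0) => // [w|w _]; first exact: rnorm_ge0.
by case/andP: (a01 w).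
Qed.

Lemma Lpw_norm_fun_ge0 f : 0 <= Lpw_norm_fun s nu p f.
Proof.
apply: le_trans (ereal_sup_ubound _); last by exists \0 => //; exact: dual_ball0.
exact: poweR_ge0.
Qed.

Lemma le_Lpw_norm_fun f g :
  (\forall w \ae semivariation s nu, (rnorm s (f w) <= rnorm s (g w))%R) ->
  Lpw_norm_fun s nu p f <= Lpw_norm_fun s nu p g.
Proof.
move=> fg; apply: ge_ereal_sup => _ [y' y'1 <-].
apply: (@le_trans _ _ (integral_normp s nu p g y' `^ p^-1)).
  by apply: le_root; [exact: integral_normp_ge0 (proj1 y'1) _|exact: le_integral_normp (proj1 y'1) _ _ fg].
by apply: ereal_sup_ubound; exists y'.
Qed.

Lemma Lpw_norm_funD f g :
  strongly_measurable s nu f -> strongly_measurable s nu g ->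
  Lpw_norm_fun s nu p (f + g)%R <= Lpw_norm_fun s nu p f + Lpw_norm_fun s nu p g.
Proof.
move=> mf mg; apply: ge_ereal_sup => _ [y' y'1 <-].
apply: le_trans (integral_normp_triangle (proj1 y'1) mf mg) _.
by apply: leeD; apply: ereal_sup_ubound; exists y'.
Qed.

Lemma Lpw_norm_funZ_le (a : K) f : strongly_measurable s nu f ->
  Lpw_norm_fun s nu p (a *: f) <= (rnorm s (a : K^o))%:E * Lpw_norm_fun s nu p f.
Proof.
move=> mf; apply: ge_ereal_sup => _ [y' y'1 <-].
apply: (le_trans (le_root _ (integral_normpZ_le (proj1 y'1) a mf))).
  exact: integral_normp_ge0 (proj1 y'1) _.
(* The root of order [p] turns the factor raised to the power [p] back into the norm of [a]. *)
rewrite poweRM ?lee_fin ?powR_ge0 ?(integral_normp_ge0 (proj1 y'1))// poweR_EFin.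
rewrite -powRrM mulfV ?gt_eqF// powRr1 ?rnorm_ge0//.
apply: lee_wpmul2l; first by rewrite lee_fin rnorm_ge0.
by apply: ereal_sup_ubound; exists y'.
Qed.

End Lp_norm.

(** * Functions of [Lp] as norm limits of simple functions *)

Section Lp_space.
Context d (Omega : measurableType d) (R : realType) (K : numFieldType).
Context (s : scalar_field R K) (X Y : normedModType K).
Variables (nu : vector_measure Omega Y) (p : R).
Hypothesis p_ge1 : 1 <= p.
Implicit Types f g : Omega -> X.

Let norm f := Lpw_norm_fun s nu p f.

(** Trades the approximating sequence for approximation within every [e], the form used in all the
    closure properties below. *)
Lemma Lp_funP f : Lp_fun s nu p f <-> strongly_measurable s nu f /\
  forall e : R, 0 < e ->
    exists g, simple_function g /\ (norm (f - g)%R < e%:E)%E.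
Proof.
split=> -[mf].
  move=> [f_ [sf /fine_cvgP[fin cvf]]]; split => // e e0.
  have [n _ hn] : \forall n \near \oo, (norm (f - f_ n)%R < e%:E)%E.
    near=> n.
    have fn : norm (f - f_ n)%R \is a fin_num by near: n; exact: fin.
    rewrite -(fineK fn) lte_fin.
    rewrite -[ltLHS]ger0_norm ?fine_ge0 ?Lpw_norm_fun_ge0//.
    rewrite -[X in `|X|]opprK normrN -sub0r.
    by near: n; exact: cvgr_dist_lt.
  by exists (f_ n); split => //; apply: hn => /=.
move=> fe; split => //.
(* The sequence is chosen with tolerance 1/(n+1) at index [n]. *)
have /choice[f_ f_P] n : exists g, simple_function g /\
    (norm (f - g)%R < (n.+1%:R^-1)%:E)%E by apply: fe; rewrite invr_gt0.
exists f_; split=> [n|]; first by case: (f_P n).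
apply: (@squeeze_cvge _ _ _ _ (fun=> 0%E) _ (fun n => (n.+1%:R^-1)%:E)).
- apply: nearW => n; rewrite Lpw_norm_fun_ge0//=.
  by case: (f_P n) => _ /ltW.
- exact: cvg_cst.
- apply/fine_cvgP; split; first exact: nearW.
  exact: cvg_harmonic.
Unshelve. all: by end_near. Qed.

Lemma simple_Lp_fun f : simple_function f -> Lp_fun s nu p f.
Proof.
move=> sf; apply/Lp_funP; split; first exact: simple_function_strongly_measurable.
move=> e e0; exists f; split => //; rewrite subrr.
(* The zero function is [0 *: f], so homogeneity shows that its norm vanishes. *)
have := @Lpw_norm_funZ_le _ _ _ _ s X Y nu p p_ge1 0 f.
move=> /(_ (simple_function_strongly_measurable _ _ sf)).
rewrite scale0r rnorm0 mul0e => h; exact: le_lt_trans h _.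
Qed.

Lemma Lp_funD f g : Lp_fun s nu p f -> Lp_fun s nu p g -> Lp_fun s nu p (f + g).
Proof.
move=> /Lp_funP[mf hf] /Lp_funP[mg hg]; apply/Lp_funP; split.
  exact: strongly_measurableD.
move=> e e0; have e20 : 0 < e / 2 by rewrite divr_gt0.
have [f' [sf' ff']] := hf _ e20; have [g' [sg' gg']] := hg _ e20.
exists (f' + g'); split; first exact: simple_functionD.
rewrite opprD addrACA [e in e%:E]splitr EFinD.
apply: le_lt_trans (lteD ff' gg'); apply: Lpw_norm_funD => //.
  exact/(strongly_measurableB mf)/simple_function_strongly_measurable.
exact/(strongly_measurableB mg)/simple_function_strongly_measurable.
Qed.

Lemma Lp_funZ (a : K) f : Lp_fun s nu p f -> Lp_fun s nu p (a *: f).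
Proof.
move=> /Lp_funP[mf hf]; apply/Lp_funP; split; first exact: strongly_measurableZ.
(* Adding 1 keeps the divisor [c] positive even when [a] is zero. *)
move=> e e0; pose c := rnorm s (a : K^o) + 1.
have c0 : 0 < c by rewrite ltr_wpDl ?rnorm_ge0.
have [g [sg fg]] := hf (e / c) (divr_gt0 e0 c0).
exists (a *: g); split; first exact: simple_functionZ.
have mfg : strongly_measurable s nu (f - g).
  exact/(strongly_measurableB mf)/simple_function_strongly_measurable.
rewrite -scalerBr; apply: le_lt_trans (Lpw_norm_funZ_le p_ge1 a mfg) _.
apply: (@le_lt_trans _ _ (c%:E * norm (f - g)%R)%E).
  by apply: lee_wpmul2r; rewrite ?Lpw_norm_fun_ge0// lee_fin lerDl.
by rewrite -lte_pdivlMl// -EFinM mulrC.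
Qed.

(** A simple function within [e / 2] of some [g] in [Lp], itself within [e / 2] of [f], is within
    [e] of [f]. *)
Lemma Lp_fun_closed f : strongly_measurable s nu f ->
  (forall e : R, 0 < e ->
    exists2 g, Lp_fun s nu p g & (norm (f - g)%R < e%:E)%E) ->
  Lp_fun s nu p f.
Proof.
move=> mf hf; apply/Lp_funP; split=> // e e0.
have e20 : 0 < e / 2 by rewrite divr_gt0.
have [g /Lp_funP[mg hg] fg] := hf _ e20.
have [h [sh gh]] := hg _ e20; exists h; split => //.
rewrite (_ : f - h = (f - g) + (g - h)); last by rewrite addrA subrK.
rewrite [e in e%:E]splitr EFinD; apply: le_lt_trans (lteD fg gh).
apply: Lpw_norm_funD => //; first exact: strongly_measurableB.
exact/(strongly_measurableB mg)/simple_function_strongly_measurable.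
Qed.

Lemma Lp_fun_Lpw_fun f : Lp_fun s nu p f -> Lpw_fun s nu p f.
Proof.
move=> /Lp_funP[mf hf]; split => //.
apply: (integral_normp_dual_ball p_ge1) => // y' y'1; have y'c := proj1 y'1.
(* One simple [g] at finite distance suffices: [f] is the sum of [f - g] and [g], both of finite
   norm for [y']. *)
have [g [sg fg]] := hf 1 ltr01.
have mg : strongly_measurable s nu g.
  exact: simple_function_strongly_measurable.
have p0 : p^-1 != 0 by rewrite invr_eq0 gt_eqF// (lt_le_trans _ p_ge1).
apply: (lty_poweRy p0); rewrite -{1}(subrK g f).
have mfg := strongly_measurableB mf mg.
apply: le_lt_trans (integral_normp_triangle p_ge1 y'c mfg mg) _.
apply: lte_add_pinfty.
  apply: (@le_lt_trans _ _ (norm (f - g)%R)); last exact: lt_trans fg (ltry _).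
  by apply: ereal_sup_ubound; exists y'.
exact/poweR_lty/integral_normp_simple.
Qed.

End Lp_space.

(** * Transfer from functions to almost everywhere classes *)

Theorem theorem3p3 (d : measure_display) (Omega : measurableType d)
    (R : realType) (K : numFieldType) (s : scalar_field R K)
    (X Y : completeNormedModType K) (nu : vector_measure Omega Y)
    (p : R) (p_ge1 : 1 <= p) :
  [/\ Lp s X nu p `<=` Lpw s X nu p,
      submod_closed [pred u | u \in Lp s X nu p] &
      norm_closed_in (Lpw_norm p) (Lpw s X nu p) (Lp s X nu p)].
Proof.
have classN f g : ae_class_of s nu f - ae_class_of s nu g =
    ae_class_of s nu (f - g) :> ae_class s X nu.
  by rewrite -{1}(subrK g f) [X in X - _]ae_class_ofD addrK.
split.
- by move=> _ [f Lf <-]; exists f => //; exact: Lp_fun_Lpw_fun.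
- split; rewrite ?inE /=.
    exists 0; first exact/simple_Lp_fun/simple_function0.
    (* The zero of the quotient is obtained as a difference of two equal classes, to which [classN]
       applies. *)
    by rewrite -(subrr (ae_class_of s nu 0)) classN subrr.
  move=> a u v; rewrite !inE => -[f Lf <-] [g Lg <-].
  exists (a *: f + g); last by rewrite ae_class_ofD ae_class_ofZ.
  exact/Lp_funD/Lg/Lp_funZ.
- move=> _ [f [mf _] <-] hf; exists f => //.
  apply: Lp_fun_closed => // e e0; have [_ [g Lg <-] fg] := hf _ e0.
  exists g; first exact: Lg.
  (* [Lpw_norm] is computed on the representative picked by [repr], which agrees with [f - g] almost
     everywhere; monotonicity of the norm absorbs the difference. *)
  move: fg; rewrite classN; apply: le_lt_trans; apply: (le_Lpw_norm_fun p_ge1).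
  have h := proj1 (ae_class_ofP s nu _ _)
    (ae_class_of_repr (ae_class_of s nu (f - g))).
  by apply: (semivariation_aeS2 _ h h) => w -> _.
Qed.
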